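(* (a) Let $A$ be a $(d-1)$-dimensional diagonally extremal $(0,1)$-matrix of order $n$, and let $B$ be the $d$-dimensional $(0,1)$-matrix of order $n$ in which, for some fixed direction $i$, every hyperplane $\Gamma_{i,j}$ ($j=1,\dots,n$) equals $A$ (that is, $b_\gamma=a_{\gamma'}$ where $\gamma'$ is obtained from $\gamma$ by deleting its $i$-th coordinate). Then $B$ is diagonally extremal. (b) Let $A$ be a $d$-dimensional diagonally extremal $(0,1)$-matrix of order $n$ with deficiency $\delta$, let $\Lambda=(\lambda_{i,j})$ be an optimal hyperplane cover of $A$, and let $\Lambda'$ be a $d\times(n+1)$ table obtained from $\Lambda$ by appending one new column in one of the following ways: (1) for an index $\alpha$ covered by $\Lambda$ with weight exactly $1$, append $\lambda_{i,\alpha_i}$ to row $i$ for every $i$; (2) append $1$ to one row and $0$ to all other rows; (3) if some row $j$ contains an entry equal to $\delta$, append $1-\delta$ to some row $i\neq j$, $\delta$ to row $j$, and $0$ to all other rows. Then $B=A(\Lambda')$ is diagonally extremal.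
   Context: A $d$-dimensional matrix of order $n$ is an array $(a_\alpha)_{\alpha\in\{1,\dots,n\}^d}$; $\mathrm{supp}(A)=\{\alpha:a_\alpha\ne0\}$; the hyperplane $\Gamma_{i,j}$ is the set of indices with $\alpha_i=j$. For an index $\alpha$, $A_\alpha$ is the submatrix of order $n-1$ obtained from $A$ by deleting all hyperplanes containing $\alpha$. A polyplex of weight $W$ is a nonnegative matrix $K$ whose entries sum to at most $1$ over each hyperplane and to $W$ in total; a polydiagonal in a matrix of order $m$ is a polyplex of weight $m$; a diagonal is a $(0,1)$-matrix with exactly one unit entry in each hyperplane. A $(0,1)$-matrix $A$ contains $K$ if $\mathrm{supp}(K)\subseteq\mathrm{supp}(A)$. A hyperplane cover of $A$ is a nonnegative $d\times n$ table $\Lambda$ with $\sum_{i=1}^d\lambda_{i,\alpha_i}\ge1$ for all $\alpha\in\mathrm{supp}(A)$; its weight is the sum of its entries; it is optimal if it has minimum weight among hyperplane covers of $A$. An index $\alpha$ is covered by $\Lambda$ with weight $\sum_i\lambda_{i,\alpha_i}$. For a nonnegative $d\times m$ table $\Lambda$, $A(\Lambda)$ is the $(0,1)$-matrix of order $m$ with support $\{\alpha:\sum_i\lambda_{i,\alpha_i}\ge1\}$. A $(0,1)$-matrix $A$ is extremal if it contains no polydiagonal, but for every $\alpha$ with $a_\alpha=0$ the matrix obtained by changing $a_\alpha$ to $1$ contains a polydiagonal; it is diagonally extremal if it contains no polydiagonal and for every $\alpha$ with $a_\alpha=0$ the submatrix $A_\alpha$ contains a diagonal. The deficiency of an extremal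 matrix of order $n$ is $n$ minus the maximum weight of a polyplex it contains. *)

(* Defs.v *)
From HB Require Import structures.
From mathcomp Require Import all_boot all_order all_algebra.
From mathcomp Require Import reals.

Set Implicit Arguments.
Unset Strict Implicit.
Unset Printing Implicit Defensive.

Import Order.TTheory GRing.Theory Num.Theory.
Local Open Scope ring_scope.

(* Indices of a [d]-dimensional matrix of order [n]; coordinates and positions
   are numbered from 0. *)
Notation mdidx d n := {ffun 'I_d -> 'I_n}.

(* [d]-dimensional matrices of order [n] with entries in [T]. *)
Notation mdmx T d n := {ffun mdidx d n -> T}.

Section Matrices.
Variables (R : realFieldType) (d n : nat).
Implicit Types (A K D : mdmx R d n) (alpha : mdidx d n).

Definition zero_one A : Prop := forall alpha, A alpha = 0 \/ A alpha = 1.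

Definition mdsupp A : {set mdidx d n} := [set alpha | A alpha != 0].

Definition contains A K : Prop := mdsupp K \subset mdsupp A.

Definition hyperplane (i : 'I_d) (j : 'I_n) : {set mdidx d n} :=
  [set alpha : mdidx d n | alpha i == j].

(* [lift (alpha i)] enumerates increasingly the positions other than
   [alpha i], so this deletes every hyperplane containing [alpha]. *)
Definition mdsub A alpha : mdmx R d n.-1 :=
  [ffun beta : mdidx d n.-1 => A [ffun i => lift (alpha i) (beta i)]].

Definition polyplex K (W : R) : Prop :=
  [/\ forall alpha, 0 <= K alpha,
      forall i j, \sum_(alpha in hyperplane i j) K alpha <= 1
    & \sum_alpha K alpha = W].

Definition polydiagonal K : Prop := polyplex K n%:R.

Definition diagonal D : Prop :=
  zero_one D /\
  forall i j, #|[set alpha in hyperplane i j | D alpha == 1]| = 1%N.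

End Matrices.

Section Extremality.
Variables (R : realFieldType) (d n : nat).
Implicit Types A : mdmx R d n.

Definition diagonally_extremal A : Prop :=
  [/\ zero_one A,
      ~ exists K, polydiagonal K /\ contains A K
    & forall alpha, A alpha = 0 ->
        exists D, diagonal D /\ contains (mdsub A alpha) D].

Definition max_polyplex_weight A (W : R) : Prop :=
  (exists K, polyplex K W /\ contains A K) /\
  (forall K W', polyplex K W' -> contains A K -> W' <= W).

Definition deficiency A (delta : R) : Prop :=
  exists W, max_polyplex_weight A W /\ delta = n%:R - W.

End Extremality.

Section Covers.
Variables (R : realFieldType) (d n : nat).
Implicit Types (A : mdmx R d n) (L : 'M[R]_(d, n)).

Definition cover_weight_at L (alpha : mdidx d n) : R := \sum_i L i (alpha i).

Definition nonneg_table L : Prop := forall i j, 0 <= L i j.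

Definition hyperplane_cover A L : Prop :=
  nonneg_table L /\
  forall alpha, alpha \in mdsupp A -> 1 <= cover_weight_at L alpha.

Definition table_weight L : R := \sum_i \sum_j L i j.

Definition optimal_cover A L : Prop :=
  hyperplane_cover A L /\
  forall L', hyperplane_cover A L' -> table_weight L <= table_weight L'.

Definition table_mx L : mdmx R d n :=
  [ffun alpha => (1 <= cover_weight_at L alpha)%R%:R].

End Covers.

(* The matrix all of whose hyperplanes in direction [i] equal [A]; here
   [lift i] skips the coordinate [i]. *)
Definition layered (R : realFieldType) (d n : nat) (i : 'I_d)
    (A : mdmx R d.-1 n) : mdmx R d n :=
  [ffun gamma : mdidx d n => A [ffun k : 'I_d.-1 => gamma (lift i k)]].

(* Main.v *)
(* By Farkas' lemma, an optimal cover [L] of [A] has weight [n - delta], so each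
   table obtained by appending a column of total weight 1 has weight below its
   order and its matrix has no polydiagonal by weak duality. Complementary
   slackness gives a zero in each row of [L] and a tight index through each
   positive entry. A zero [alpha'] of [A] has weight at most [1 - delta], since
   it completes a diagonal of [A_alpha'] whose other units weigh at least 1; in
   particular [A] is the matrix of [L]. For a zero [alpha] of the new matrix one
   picks a zero [alpha'] of [A], takes a diagonal of [A_alpha'] together with
   [alpha'], and swaps in every row the position [alpha k] with the new one; only
   the weight of the image of [alpha'] has to be checked. *)
Require Import Defs.
From HB Require Import structures.
From mathcomp Require Import all_boot all_order all_algebra.
From mathcomp Require Import reals.
From mathcomp Require Import ring lra.

Set Implicit Arguments.
Unset Strict Implicit.
Unset Printing Implicit Defensive.

Import Order.TTheory GRing.Theory Num.Theory.
Local Open Scope ring_scope.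

(** * Farkas' lemma for finite systems of linear inequalities *)

Section Farkas.
Variables (R : realFieldType) (T : finType).

Local Notation constraint := ({ffun T -> R^o} * R^o)%type.
Implicit Types (p q : constraint) (s : seq constraint) (x : T -> R).

(* The pair [p] stands for the inequality [p.2 <= \sum_v p.1 v * x v]. *)
Definition satisfies x p : bool := p.2 <= \sum_v p.1 v * x v.

(** The inequalities derivable from [s] by adding and by nonnegative scaling. Being inductive, it
    lets certificates of infeasibility be analysed by induction. *)
Inductive cone s : constraint -> Prop :=
| cone_mem p : p \in s -> cone s p
| cone_add p q : cone s p -> cone s q -> cone s (p + q)
| cone_scale (a : R) p : 0 <= a -> cone s p -> cone s (a *: p).

Lemma cone_trans s s' p :
  (forall q, q \in s' -> cone s q) -> cone s' p -> cone s p.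
Proof.
move=> ss'; elim=> [q /ss'//|q r _ hq _ hr|a q a0 _ hq].
  exact: cone_add.
exact: cone_scale.
Qed.

(** Supplies the value of an eliminated variable from its lower and upper bounds; either list may be
    empty. *)
Lemma exists_between (lo up : seq R) :
  (forall l u, l \in lo -> u \in up -> l <= u) ->
  exists t, (forall l, l \in lo -> l <= t) /\ (forall u, u \in up -> t <= u).
Proof.
elim: lo => [_|l lo IH loup].
  elim: up => [|u up [t [_ tup]]]; first by exists 0.
  exists (Num.min u t); split=> // v; rewrite inE => /predU1P[->|/tup tv].
    by rewrite ge_min lexx.
  by rewrite ge_min tv orbT.
have [|t [lot tup]] := IH.
  by move=> l' u l'lo; apply: loup; rewrite inE l'lo orbT.
exists (Num.max l t); split=> [l'|u uup].
  rewrite inE => /predU1P[->|/lot l't]; first by rewrite le_max lexx.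
  by rewrite le_max l't orbT.
by rewrite ge_max tup // andbT; apply: loup; rewrite // inE eqxx.
Qed.

(** Cancels [v]; both factors are positive when [q.1 v < 0 < p.1 v], so the result stays in the
    cone. *)
Definition eliminate v p q : constraint := (- q.1 v) *: p + p.1 v *: q.

Lemma eliminateE v p q w :
  (eliminate v p q).1 w = - q.1 v * p.1 w + p.1 v * q.1 w.
Proof. by rewrite /eliminate /= !ffunE. Qed.

(* Fourier-Motzkin elimination of the variables in [vs]. *)
Lemma farkas_supported (vs : seq T) s :
  (forall p v, p \in s -> v \notin vs -> p.1 v = 0) ->
  (exists x, forall p, p \in s -> satisfies x p) \/
  (exists p, [/\ cone s p, p.1 = 0 & 0 < p.2]).
Proof.
elim: vs s => [|v vs IH] s svs.
  (* Without variables each constraint reads [p.2 <= 0]: either all hold, or a false one is the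
     certificate. *)
  have [/allP sle|/allPn[p ps]] := boolP (all (fun p => p.2 <= 0) s).
    left; exists (fun=> 0) => p ps; rewrite /satisfies big1 ?sle // => w _.
    by rewrite mulr0.
  rewrite -ltNge => p2; right; exists p; split=> //; first exact: cone_mem.
  by apply/ffunP => w; rewrite svs // ffunE.
pose s0 := [seq p : constraint <- s | p.1 v == 0].
pose sp := [seq p : constraint <- s | 0 < p.1 v].
pose sn := [seq p : constraint <- s | p.1 v < 0].
pose s' := s0 ++ [seq eliminate v p q | p <- sp, q <- sn].
have [|[x xs']|[p [ps' p1 p2]]] := IH s'.
- move=> p w; rewrite mem_cat mem_filter => /[swap] wvs /orP[/andP[/eqP pv ps]|].
    have [->//|wv] := eqVneq w v.
    by apply: svs => //; rewrite inE negb_or wv.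
  case/allpairsP=> -[q r] /= [].
  rewrite !mem_filter => /andP[qv qs] /andP[rv rs] ->.
  rewrite eliminateE; have [->|wv] := eqVneq w v; first by ring.
  by rewrite !(svs _ w) // ?inE ?negb_or ?wv // !mulr0 addr0.
- left.
  (* For fixed values of the other variables, [root p] is the bound that [p] puts on [v]: a lower
     one for [p] in [sp], an upper one for [p] in [sn]. *)
  pose rest p := \sum_(w | w != v) p.1 w * x w.
  pose root p := (p.2 - rest p) / p.1 v.
  have sumE p : \sum_w p.1 w * x w = p.1 v * x v + rest p.
    by rewrite (bigD1 v).
  have [|t [lot tup]] := @exists_between [seq root p | p <- sp] [seq root p | p <- sn].
    move=> _ _ /mapP[p psp ->] /mapP[q qsn ->].
    have := xs' (eliminate v p q); rewrite /satisfies sumE eliminateE.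
    have -> : rest (eliminate v p q) = - q.1 v * rest p + p.1 v * rest q.
      rewrite /rest !mulr_sumr -big_split /=; apply: eq_bigr => w _.
      by rewrite eliminateE; ring.
    move: (psp) (qsn); rewrite !mem_filter => /andP[pv ps] /andP[qv qs].
    rewrite mem_cat allpairs_f ?orbT // => /(_ isT) /=.
    have e a b : (a : R) *: (b : R^o) = a * b by [].
    rewrite !e => h.
    rewrite /root ler_ndivlMr // mulrAC ler_pdivlMr //.
    lra.
  exists (fun w => if w == v then t else x w) => p ps.
  rewrite /satisfies (bigD1 v) //= eqxx.
  under eq_bigr => w wv do rewrite (negbTE wv).
  rewrite -/(rest p) -lerBlDr.
  case: (ltgtP (p.1 v) 0) => [pv|pv|pv].
  + rewrite mulrC -ler_ndivlMr //; apply: tup; apply: map_f.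
    by rewrite mem_filter pv.
  + rewrite mulrC -ler_pdivrMr //; apply: lot; apply: map_f.
    by rewrite mem_filter pv.
  + have := xs' p; rewrite /satisfies sumE mem_cat mem_filter pv eqxx ps.
    by move=> /(_ isT); rewrite !mul0r add0r subr_le0.
- right; exists p; split=> //; apply: cone_trans ps' => q.
  rewrite mem_cat mem_filter => /orP[/andP[_ qs]|]; first exact: cone_mem.
  case/allpairsP=> -[q1 q2] /= [].
  rewrite !mem_filter => /andP[q1v q1s] /andP[q2v q2s] ->.
  apply: cone_add; apply: cone_scale; rewrite ?oppr_ge0 ?ltW //;
    exact: cone_mem.
Qed.

Lemma farkas s :
  (exists x, forall p, p \in s -> satisfies x p) \/
  (exists p, [/\ cone s p, p.1 = 0 & 0 < p.2]).
Proof.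
by apply: (@farkas_supported (enum T)) => p v _; rewrite mem_enum.
Qed.

End Farkas.

(** * Linear programming duality between polyplexes and hyperplane covers *)

Section Duality.
Variables (R : realFieldType) (d n : nat).
Implicit Types (A K : mdmx R d n) (L : 'M[R]_(d, n)).

Definition hyperplane_sum K (k : 'I_d) (s : 'I_n) : R :=
  \sum_(alpha in hyperplane k s) K alpha.

Lemma sum_hyperplane_sum K k : \sum_s hyperplane_sum K k s = \sum_alpha K alpha.
Proof.
rewrite (partition_big (fun alpha : mdidx d n => alpha k) predT) //=.
by apply: eq_bigr => s _; apply: eq_bigl => alpha; rewrite inE.
Qed.

(** Double counting of the pairs formed by an index and a hyperplane through it. *)
Lemma sum_cover_weight K L :
  \sum_alpha K alpha * cover_weight_at L alpha =
  \sum_k \sum_s L k s * hyperplane_sum K k s.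
Proof.
under eq_bigr do rewrite mulr_sumr.
rewrite exchange_big; apply: eq_bigr => k _.
rewrite (partition_big (fun alpha : mdidx d n => alpha k) predT) //=.
apply: eq_bigr => s _; rewrite mulr_sumr.
apply: eq_big => [alpha|alpha /eqP <-]; first by rewrite inE.
by rewrite mulrC.
Qed.

Section WeakDuality.
Variables (A K : mdmx R d n) (L : 'M[R]_(d, n)) (W : R).
Hypotheses (KW : polyplex K W) (AK : contains A K) (AL : hyperplane_cover A L).

Let slack_row k s : 0 <= L k s * (1 - hyperplane_sum K k s).
Proof.
case: KW AL => _ K1 _ [L0 _].
by apply: mulr_ge0; rewrite ?subr_ge0; [apply: L0 | apply: K1].
Qed.

Let slack_idx alpha : 0 <= K alpha * (cover_weight_at L alpha - 1).
Proof.
case: KW AL => K0 _ _ [_ L1].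
have [->|Ka] := eqVneq (K alpha) 0; first by rewrite mul0r.
by rewrite mulr_ge0 // subr_ge0 L1 // (subsetP AK) // inE.
Qed.

(** The duality gap is a sum of nonnegative slacks: this gives weak duality at once, and
    complementary slackness when the gap vanishes. *)
Let gapE : table_weight L - W =
  \sum_k \sum_s L k s * (1 - hyperplane_sum K k s) +
  \sum_alpha K alpha * (cover_weight_at L alpha - 1).
Proof.
case: KW => _ _ <-.
under [X in _ = _ + X]eq_bigr do rewrite mulrBr mulr1.
rewrite sumrB sum_cover_weight /table_weight.
under [X in _ = X + _]eq_bigr do under eq_bigr do rewrite mulrBr mulr1.
under [X in _ = X + _]eq_bigr do rewrite sumrB.
rewrite sumrB; ring.
Qed.

Lemma weak_duality : W <= table_weight L.
Proof.
rewrite -subr_ge0 gapE addr_ge0 ?sumr_ge0 // => k _.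
by rewrite sumr_ge0.
Qed.

Lemma complementary_slackness : table_weight L = W ->
  (forall k s, L k s != 0 -> hyperplane_sum K k s = 1) /\
  (forall alpha, K alpha != 0 -> cover_weight_at L alpha = 1).
Proof.
move=> LW; move: gapE; rewrite LW subrr => /esym/eqP.
have rows k : 0 <= \sum_s L k s * (1 - hyperplane_sum K k s) by rewrite sumr_ge0.
rewrite paddr_eq0 ?sumr_ge0 // => /andP[/eqP eL /eqP eK]; split=> [k s Lks|alpha Ka].
  have eLk : \sum_s L k s * (1 - hyperplane_sum K k s) = 0.
    by apply: (psumr_eq0P _ eL) => // k' _; apply: rows.
  have : L k s * (1 - hyperplane_sum K k s) = 0.
    by apply: (psumr_eq0P _ eLk) => // s' _; apply: slack_row.
  by move/eqP; rewrite mulf_eq0 (negbTE Lks) subr_eq0 => /eqP.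
have : K alpha * (cover_weight_at L alpha - 1) = 0.
  by apply: (psumr_eq0P _ eK) => // a _; apply: slack_idx.
by move/eqP; rewrite mulf_eq0 (negbTE Ka) subr_eq0 => /eqP.
Qed.

End WeakDuality.

(** The cover is a solution of a linear system with one variable per hyperplane; a Farkas
    certificate against it would yield a polyplex heavier than [W]. *)
Lemma exists_cover_le A W : (0 < d)%N -> max_polyplex_weight A W ->
  exists L, hyperplane_cover A L /\ table_weight L <= W.
Proof.
move=> d0 [_ maxW].
pose T := ('I_d * 'I_n)%type.
(* [cov alpha] asks that [alpha] be covered, [pos w] that the entry at [w] be nonnegative, and [tot]
   that the total weight be at most [W]. *)
pose cov (alpha : mdidx d n) : {ffun T -> R^o} * R^o :=
  ([ffun v => (alpha v.1 == v.2)%:R], 1).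
pose pos (w : T) : {ffun T -> R^o} * R^o := ([ffun v => (v == w)%:R], 0).
pose tot : {ffun T -> R^o} * R^o := ([ffun=> -1], - W).
pose s := tot :: [seq cov alpha | alpha <- enum (mdsupp A)] ++ [seq pos w | w <- enum {: T}].
have [[x xs]|[p [ps p1 p2]]] := farkas s.
  exists (\matrix_(k, j) x (k, j)); split; first split.
  - move=> k j; rewrite mxE; have := xs (pos (k, j)).
    rewrite inE mem_cat map_f ?mem_enum // !orbT => /(_ isT).
    rewrite /satisfies (bigD1 (k, j)) //= ffunE eqxx mul1r big1 ?addr0 //.
    by move=> v /negbTE vkj; rewrite ffunE vkj mul0r.
  - move=> alpha aA; have := xs (cov alpha).
    rewrite inE mem_cat map_f ?mem_enum // orbT => /(_ isT).
    rewrite /satisfies /cover_weight_at.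
    suff -> : \sum_v (cov alpha).1 v * x v = \sum_k x (k, alpha k).
      by under [X in _ -> _ <= X]eq_bigr do rewrite mxE.
    transitivity (\sum_k \sum_j (cov alpha).1 (k, j) * x (k, j)).
      by rewrite pair_bigA; apply: eq_bigr => -[].
    apply: eq_bigr => k _; rewrite (bigD1 (alpha k)) //= ffunE eqxx mul1r.
    rewrite big1 ?addr0 // => j /negbTE.
    by rewrite ffunE /= eq_sym => ->; rewrite mul0r.
  - have := xs tot; rewrite inE eqxx => /(_ isT); rewrite /satisfies /=.
    under eq_bigr do rewrite ffunE mulN1r.
    rewrite sumrN lerN2 => xW.
    rewrite /table_weight; under eq_bigr do under eq_bigr do rewrite mxE.
    by rewrite pair_bigA; under eq_bigr do rewrite -surjective_pairing.
(* Up to scaling by [m], the contradiction [p] is a polyplex of weight above [W]. *)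
have [K [m [K0 AK m0 Km p2E]]] : exists K m,
    [/\ forall alpha, 0 <= K alpha, contains A K, 0 <= m,
        forall k j, hyperplane_sum K k j - m <= p.1 (k, j)
      & p.2 = \sum_alpha K alpha - m * W].
  (* [m] collects the multiples of [tot] and [K alpha] those of [cov alpha]. Multiples of [pos] only
     raise the coefficients, hence an inequality for [p.1]. *)
  elim: ps => {p p1 p2}[p|p q _ [K [m [K0 AK m0 Km p2E]]] _ [K' [m' [K'0 AK' m'0 K'm' q2E]]]
    |a p a0 _ [K [m [K0 AK m0 Km p2E]]]].
  - rewrite inE mem_cat => /or3P[/eqP->|/mapP[alpha aA ->]|/mapP[w _ ->]].
    + exists [ffun=> 0], 1; split=> // [alpha||k j|].
      * by rewrite ffunE.
      * by apply/subsetP => alpha; rewrite inE ffunE eqxx.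
      * by rewrite /hyperplane_sum big1 ?sub0r ?ffunE // => ? _; rewrite ffunE.
      * by rewrite big1 ?sub0r ?mul1r // => ? _; rewrite ffunE.
    + exists [ffun beta => (beta == alpha)%:R], 0; split=> // [beta||k j|].
      * by rewrite ffunE ler0n.
      * apply/subsetP => beta; rewrite inE ffunE pnatr_eq0 eqb0 negbK => /eqP->.
        by rewrite mem_enum in aA.
      * rewrite subr0 /hyperplane_sum ffunE /= big_mkcond (bigD1 alpha) //=.
        rewrite ffunE eqxx inE big1 ?addr0; first by case: eqP.
        by move=> beta /negbTE ba; rewrite ffunE ba if_same.
      * rewrite mul0r subr0 (bigD1 alpha) //= ffunE eqxx big1 ?addr0 //.
        by move=> beta /negbTE ba; rewrite ffunE ba.
    + exists [ffun=> 0], 0; split=> // [alpha||k j|].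
      * by rewrite ffunE.
      * by apply/subsetP => alpha; rewrite inE ffunE eqxx.
      * rewrite /hyperplane_sum big1 ?sub0r ?ffunE ?oppr0 ?ler0n // => ? _.
        by rewrite ffunE.
      * by rewrite big1 ?sub0r ?mul0r ?oppr0 // => ? _; rewrite ffunE.
  - exists [ffun alpha => K alpha + K' alpha], (m + m'); split.
    + by move=> alpha; rewrite ffunE addr_ge0.
    + apply/subsetP => alpha; rewrite inE ffunE => KK'.
      have [Ka|Ka] := eqVneq (K alpha) 0.
        by apply: (subsetP AK'); rewrite inE; rewrite Ka add0r in KK'.
      by apply: (subsetP AK); rewrite inE.
    + exact: addr_ge0.
    + move=> k j; rewrite /hyperplane_sum; under eq_bigr do rewrite ffunE.
      rewrite big_split /= ffunE; have := Km k j; have := K'm' k j.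
      rewrite /hyperplane_sum; lra.
    + under eq_bigr do rewrite ffunE.
      rewrite big_split /= p2E q2E; ring.
  - exists [ffun alpha => a * K alpha], (a * m); split.
    + by move=> alpha; rewrite ffunE mulr_ge0.
    + apply/subsetP => alpha; rewrite inE ffunE mulf_eq0 negb_or => /andP[_ Ka].
      by apply: (subsetP AK); rewrite inE.
    + exact: mulr_ge0.
    + move=> k j; rewrite /hyperplane_sum; under eq_bigr do rewrite ffunE.
      rewrite -mulr_sumr /= ffunE -mulrBr.
      by apply: (ler_wpM2l a0); apply: Km.
    + under eq_bigr do rewrite ffunE.
      by rewrite -mulr_sumr /= p2E /GRing.scale /= mulrBr mulrA.
have Km' k j : hyperplane_sum K k j <= m.
  by have := Km k j; rewrite p1 ffunE subr_le0.
move: p2; rewrite p2E subr_gt0 => mW.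
(* If [m = 0], the hyperplane sums in one direction are at most 0, yet their total is positive.
   Otherwise [K / m] is the forbidden polyplex. *)
move: m0; rewrite le_eqVlt => /predU1P[m0|m0].
  move: mW; rewrite -m0 mul0r ltNge -(sum_hyperplane_sum K (Ordinal d0)).
  by rewrite sumr_le0 // => j _; rewrite m0.
have KmW : polyplex [ffun alpha => K alpha / m] (\sum_alpha K alpha / m).
  split=> [alpha|k j|]; first by rewrite ffunE divr_ge0 // ltW.
    under eq_bigr do rewrite ffunE.
    by rewrite -mulr_suml ler_pdivrMr // mul1r; apply: Km'.
  by apply: eq_bigr => alpha _; rewrite ffunE.
have AKm : contains A [ffun alpha => K alpha / m].
  apply/subsetP => alpha; rewrite inE ffunE mulf_eq0 negb_or => /andP[Ka _].
  by apply: (subsetP AK); rewrite inE.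
have := maxW _ _ KmW AKm.
by rewrite -mulr_suml ler_pdivrMr // mulrC leNgt mW.
Qed.

Lemma strong_duality A L W : (0 < d)%N ->
  max_polyplex_weight A W -> optimal_cover A L -> table_weight L = W.
Proof.
move=> d0 AW [AL minL]; have [L' [AL' L'W]] := exists_cover_le d0 AW.
apply/eqP; rewrite eq_le (le_trans (minL _ AL') L'W) /=.
by case: AW => -[K [KW AK]] _; apply: weak_duality KW AK AL.
Qed.

End Duality.

(** * Diagonals as families of indices that differ pairwise in every coordinate *)

Definition transversal (d n : nat) (T : Type) (g : T -> mdidx d n) : Prop :=
  forall k, injective (fun t => g t k).

(** The units are listed by their first coordinate; two that share any coordinate lie in a common
    hyperplane and so coincide. *)
Lemma transversal_diagonal (R : realFieldType) (d n : nat) (D : mdmx R d n) :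
  (0 < d)%N -> diagonal D ->
  exists g : 'I_n -> mdidx d n, transversal g /\ forall t, D (g t) = 1.
Proof.
move=> d0 [_ D1]; pose k0 := Ordinal d0.
have Dg k t : exists alpha, [set beta in hyperplane k t | D beta == 1] = [set alpha].
  by apply/cards1P; rewrite D1.
have {}Dg t : exists alpha : mdidx d n, alpha k0 = t /\ D alpha = 1.
  have [alpha /setP/(_ alpha)] := Dg k0 t.
  by rewrite !inE eqxx => /andP[/eqP a0 /eqP a1]; exists alpha.
have [g gP] := fin_all_exists Dg; have g1 t := (gP t).2.
exists g; split=> // k t u /= gtu.
rewrite -(gP t).1 -(gP u).1; congr (fun_of_fin _ _).
have /eqP/cards1P[c /setP kc] := D1 k (g t k).
have := kc (g t); have := kc (g u); rewrite !inE -gtu !g1 !eqxx.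
by move=> /esym/eqP -> /esym/eqP ->.
Qed.

(** Indices avoiding [alpha] in every coordinate survive in the submatrix after renumbering, and
    there are as many of them as its order. *)
Lemma diagonal_of_transversal (R : realFieldType) (d n : nat) (A : mdmx R d n)
    (alpha : mdidx d n) (T : finType) (g : T -> mdidx d n) :
  #|T| = n.-1 -> transversal g -> (forall t k, g t k != alpha k) ->
  (forall t, A (g t) != 0) ->
  exists D, diagonal D /\ contains (mdsub A alpha) D.
Proof.
move=> cT g_inj g_alpha Ag.
have ex t k : exists s, g t k == lift (alpha k) s.
  have := g_alpha t k; rewrite eq_sym => /unlift_some[s -> _].
  by exists s.
pose b t : mdidx d n.-1 := [ffun k => xchoose (ex t k)].
have bE t k : lift (alpha k) (b t k) = g t k.
  by rewrite ffunE; apply/esym/eqP/(xchooseP (ex t k)).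
have b_inj k : injective (fun t => b t k).
  by move=> t u /(congr1 (lift (alpha k))); rewrite !bE => /g_inj.
have bP (beta : mdidx d n.-1) : reflect (exists t, beta = b t) (beta \in codom b).
  by apply: (iffP codomP).
exists [ffun beta => (beta \in codom b)%:R]; split; first split.
- by move=> beta; rewrite ffunE; case: (_ \in _); [right | left].
(* An injection between sets of equal size is a bijection; its inverse [u] locates the single unit
   of each hyperplane. *)
- move=> k s; have [|u _ uK] := inj_card_bij (b_inj k); first by rewrite card_ord cT.
  apply/eqP/cards1P; exists (b (u s)); apply/setP => beta.
  rewrite !inE ffunE pnatr_eq1 eqb1; apply/andP/eqP => [[/eqP <- /bP[t ->]]|->].
    by congr b; apply: (b_inj k); rewrite uK.
  by rewrite uK eqxx codom_f.
- apply/subsetP => beta; rewrite !inE !ffunE pnatr_eq0 eqb0 negbK => /bP[t ->].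
  suff -> : [ffun k => lift (alpha k) (b t k)] = g t by [].
  by apply/ffunP => k; rewrite ffunE bE.
Qed.

(** [None] holds the zero itself, and [Some] the units of a diagonal of its submatrix, in the
    numbering of [A]. *)
Lemma zero_transversal (R : realFieldType) (d n : nat) (A : mdmx R d n)
    (alpha : mdidx d n) : (0 < d)%N -> diagonally_extremal A -> A alpha = 0 ->
  exists g : option 'I_n.-1 -> mdidx d n,
    [/\ transversal g, g None = alpha & forall t, A (g (Some t)) != 0].
Proof.
move=> d0 [_ _ exA] /exA[D [/(transversal_diagonal d0)[b [b_inj Db]] AD]].
exists (fun t => if t is Some s then [ffun k => lift (alpha k) (b s k)] else alpha).
split=> // [k [t|] [u|]|t] //=.
- by rewrite !ffunE => /lift_inj/b_inj ->.
- by rewrite ffunE => /esym/eqP; rewrite (negbTE (neq_lift _ _)).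
- by rewrite ffunE => /eqP; rewrite (negbTE (neq_lift _ _)).
- have := subsetP AD (b t); rewrite !inE Db ffunE oner_neq0 => /(_ isT).
  by [].
Qed.

(** * Repeating a matrix along a new direction *)

(** Summing along direction [i] would turn a polydiagonal of the layered matrix into one of [A].
    Conversely, a diagonal for the projected zero lifts by giving its units distinct [i]-th
    coordinates other than [gamma i]. *)
Lemma layered_diagonally_extremal (R : realFieldType) (d n : nat) (i : 'I_d) (A : mdmx R d.-1 n) :
  (1 < d)%N -> diagonally_extremal A -> diagonally_extremal (layered i A).
Proof.
move=> d1 exA; have [A01 A_no _] := exA.
pose pr (gamma : mdidx d n) : mdidx d.-1 n := [ffun k => gamma (lift i k)].
split=> [gamma|[K [[K0 K1 KW] AK]]|gamma].
- by rewrite ffunE.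
- apply: A_no; exists [ffun beta => \sum_(gamma | pr gamma == beta) K gamma].
  split; first split.
  + by move=> beta; rewrite ffunE sumr_ge0.
  + move=> k s; apply: le_trans (K1 (lift i k) s); rewrite le_eqVlt; apply/orP; left.
    rewrite [eqbRHS](partition_big pr (fun beta => beta \in hyperplane k s)) /=; last first.
      by move=> gamma; rewrite !inE ffunE.
    apply/eqP/eq_bigr => beta; rewrite inE ffunE => /eqP bks; apply: eq_bigl => gamma.
    rewrite inE andbC; case: eqP => //= pb; move: bks; rewrite -pb ffunE => ->.
    by rewrite eqxx.
  + rewrite -KW [RHS](partition_big pr predT) //=.
    by apply: eq_bigr => beta _; rewrite ffunE.
  + apply/subsetP => beta; rewrite !inE ffunE; apply: contraNneq => Ab.
    rewrite big1 // => gamma /eqP pb; apply/eqP; apply: contraT => Kg.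
    by have := subsetP AK gamma; rewrite !inE Kg ffunE -/(pr gamma) pb Ab eqxx => /(_ isT).
- rewrite ffunE -/(pr gamma) => /(zero_transversal _ exA)[|g [g_inj gN Ag]].
    by rewrite -ltnS prednK // ltnW.
  pose h t : mdidx d n :=
    [ffun k => if unlift i k is Some k' then g (Some t) k' else lift (gamma i) t].
  apply: (@diagonal_of_transversal _ _ _ _ _ _ h); first by rewrite card_ord.
  + move=> k t u; rewrite !ffunE; case: unliftP => [k' _ /g_inj []|_] //.
    exact: lift_inj.
  + move=> t k; rewrite ffunE; case: unliftP => [k' ->|->].
      have := g_inj k' (Some t) None; rewrite gN ffunE => gt.
      by apply/eqP => /gt.
    by rewrite eq_sym neq_lift.
  + move=> t; rewrite ffunE; suff -> : [ffun k => h t (lift i k)] = g (Some t) by [].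
    by apply/ffunP => k; rewrite !ffunE liftK.
Qed.

(** * Optimal covers of a diagonally extremal matrix, and appending a column to them *)

Section Extension.
Variables (R : realFieldType) (d n : nat) (A : mdmx R d n) (delta : R) (L : 'M[R]_(d, n)).
Hypotheses (d0 : (0 < d)%N) (exA : diagonally_extremal A) (defA : deficiency A delta).
Hypothesis optL : optimal_cover A L.

Lemma table_weight_deficiency : table_weight L = n%:R - delta.
Proof.
have [W [AW ->]] := defA; rewrite (strong_duality d0 AW optL); ring.
Qed.

(** Summing over the hyperplanes of one direction bounds the weight by [n], and weight [n] would be
    a polydiagonal. *)
Lemma deficiency_gt0 : 0 < delta.
Proof.
have [W [AW ->]] := defA; have [[K [KW AK]] _] := AW; rewrite subr_gt0 lt_neqAle.
apply/andP; split.
  by apply/eqP => Wn; have [_ []] := exA; exists K; rewrite /polydiagonal -Wn.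
have [_ K1 <-] := KW; rewrite -(sum_hyperplane_sum K (Ordinal d0)).
by apply: le_trans (ler_sum _ (fun j _ => K1 (Ordinal d0) j)) _; rewrite sumr_const card_ord.
Qed.

Lemma order_gt0 : (0 < n)%N.
Proof.
case: (posnP n) => // n0; have := deficiency_gt0.
have := table_weight_deficiency; have [[L0 _] _] := optL.
have : 0 <= table_weight L by rewrite /table_weight; do 2!apply: sumr_ge0 => ? _.
have -> : n%:R = 0 :> R by rewrite n0.
lra.
Qed.

(** In each row the family visits every position exactly once. *)
Lemma sum_transversal_weight (T : finType) (g : T -> mdidx d n) :
  #|T| = n -> transversal g -> \sum_t cover_weight_at L (g t) = table_weight L.
Proof.
move=> cT g_inj; rewrite exchange_big; apply: eq_bigr => k _.
rewrite [RHS](reindex (fun t => g t k)) //.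
by apply: onW_bij; apply: inj_card_bij (g_inj k) _; rewrite card_ord cT.
Qed.

Lemma zero_weight_le alpha : A alpha = 0 -> cover_weight_at L alpha <= 1 - delta.
Proof.
move=> /(zero_transversal d0 exA)[g [g_inj gN Ag]].
have [[_ L1] _] := optL; have n0 := order_gt0.
have := sum_transversal_weight _ g_inj; rewrite card_option card_ord prednK // => /(_ erefl).
rewrite table_weight_deficiency (bigD1 None) //= gN => wE.
suff : n%:R - 1 <= \sum_(t | t != None) cover_weight_at L (g t) by lra.
have -> : n%:R - 1 = \sum_(t : option 'I_n.-1 | t != None) 1 :> R.
  rewrite sumr_const -{1}(prednK n0) -addn1 natrD addrK; congr (_ *+ _).
  have := cardC1 (None : option 'I_n.-1); rewrite card_option card_ord /= => {1}<-.
  by apply: eq_card => t; rewrite !inE.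
by apply: ler_sum => -[t _|//]; rewrite L1 // inE.
Qed.

Lemma zero_weight_lt1 alpha : (A alpha == 0) = (cover_weight_at L alpha < 1).
Proof.
apply/eqP/idP => [/zero_weight_le|].
  by have := deficiency_gt0; lra.
by case: optL => -[_ L1] _; apply: contraTeq => Aa; rewrite -leNgt L1 // inE.
Qed.

(** If row [k] were positive throughout, all hyperplane sums in direction [k] of a maximum polyplex
    would be 1, making its weight [n]. *)
Lemma exists_zero_entry k : exists s, L k s = 0.
Proof.
have [W [AW deltaE]] := defA; have [[K [KW AK]] _] := AW; have [AL _] := optL.
have [slack _] := complementary_slackness KW AK AL (strong_duality d0 AW optL).
have [s /eqP|Lk] := pickP (fun s => L k s == 0); first by exists s.
have [_ _ KWE] := KW.
have := deficiency_gt0; rewrite deltaE -KWE -(sum_hyperplane_sum K k).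
under eq_bigr => s _ do rewrite slack ?Lk //.
by rewrite sumr_const card_ord subrr ltxx.
Qed.

(** By slackness a maximum polyplex has sum 1 on this hyperplane, hence a nonzero entry there, and
    its index is tight. *)
Lemma exists_tight_index k s : L k s != 0 ->
  exists gamma : mdidx d n, gamma k = s /\ cover_weight_at L gamma = 1.
Proof.
move=> Lks; have [W [AW _]] := defA; have [[K [KW AK]] _] := AW; have [AL _] := optL.
have [slack tight] := complementary_slackness KW AK AL (strong_duality d0 AW optL).
have [gamma /andP[/eqP gk /tight g1]|K0] := pickP (fun a : mdidx d n => (a k == s) && (K a != 0)).
  by exists gamma.
have := slack _ _ Lks; rewrite /hyperplane_sum big1 => [/esym/eqP|alpha].
  by rewrite oner_eq0.
by rewrite inE => ak; have := K0 alpha; rewrite ak => /negbFE/eqP.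
Qed.

(** The transposition of [a] with the new last position, restricted to the old positions; it is the
    plain inclusion when [a] is the new position. *)
Definition swap_new (a : 'I_(n + 1)) (s : 'I_n) : 'I_(n + 1) :=
  if lshift 1 s == a then rshift n ord0 else lshift 1 s.

Lemma swap_new_neq a s : swap_new a s != a.
Proof.
rewrite /swap_new; case: ifPn => [/eqP <-|//].
by rewrite eq_rlshift.
Qed.

Lemma swap_new_inj a : injective (swap_new a).
Proof.
move=> s t; rewrite /swap_new; do 2!case: eqP => //; last by move=> _ _ /lshift_inj.
- by move=> <- /lshift_inj.
- by move=> _ _ /eqP; rewrite eq_rlshift.
- by move=> _ _ /eqP; rewrite eq_lrshift.
Qed.

(** The other units of the transversal through [alpha'] avoid it in every row, so their weights do
    not drop; an entry may decrease only at [alpha' k], which affects the image of [alpha']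
    alone. *)
Lemma swap_diagonal (M : 'M[R]_(d, n + 1)) (alpha : mdidx d (n + 1)) (alpha' : mdidx d n) :
  cover_weight_at L alpha' < 1 ->
  (forall k s, s != alpha' k -> L k s <= M k (swap_new (alpha k) s)) ->
  1 <= \sum_k M k (swap_new (alpha k) (alpha' k)) ->
  exists D, diagonal D /\ contains (mdsub (table_mx M) alpha) D.
Proof.
rewrite -zero_weight_lt1 => /eqP/(zero_transversal d0 exA)[g [g_inj gN Ag]] LM M1.
pose h t : mdidx d (n + 1) := [ffun k => swap_new (alpha k) (g t k)].
apply: (@diagonal_of_transversal _ _ _ _ _ _ h).
- by rewrite card_option card_ord prednK ?order_gt0 // addn1.
- by move=> k t u; rewrite !ffunE => /swap_new_inj/g_inj.
- by move=> t k; rewrite ffunE swap_new_neq.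
- move=> t; rewrite ffunE pnatr_eq0 eqb0 negbK.
  rewrite /cover_weight_at; under eq_bigr do rewrite ffunE.
  case: t => [t|]; last by rewrite gN.
  have [[_ L1] _] := optL.
  apply: le_trans (L1 (g (Some t)) _) _; first by rewrite inE.
  apply: ler_sum => k _; apply: LM; rewrite -gN.
  by apply/eqP => /g_inj.
Qed.

(* A positive entry below [delta] would give a zero of weight strictly between
   [1 - delta] and [1], by lowering a tight index through it to a zero entry. *)
Lemma entry_lt_deficiency k s : L k s < delta -> L k s = 0.
Proof.
move=> Ld; apply/eqP; apply: contraT => Lks; have [[L0 _] _] := optL.
have [gamma [gk]] := exists_tight_index Lks; have [z Lz] := exists_zero_entry k.
pose beta : mdidx d n := [ffun l => if l == k then z else gamma l].
have -> : cover_weight_at L gamma = L k s + cover_weight_at L beta.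
  rewrite /cover_weight_at (bigD1 k) //= gk [X in _ = _ + X](bigD1 k) //=.
  rewrite ffunE eqxx Lz add0r; congr (_ + _); apply: eq_bigr => l /negbTE lk.
  by rewrite ffunE lk.
move=> w1; have Lk0 : 0 < L k s by rewrite lt_def Lks L0.
have /eqP/zero_weight_le : A beta == 0 by rewrite zero_weight_lt1; lra.
lra.
Qed.

Section AppendedColumn.
Variable c : 'cV[R]_d.
Hypotheses (c_ge0 : forall k, 0 <= c k ord0) (sum_c : \sum_k c k ord0 = 1).
Local Notation M := (row_mx L c).
Implicit Type alpha : mdidx d (n + 1).

Lemma appended_ge0 k a : 0 <= M k a.
Proof.
have [[L0 _] _] := optL.
by case: (split_ordP a) => s ->; rewrite ?row_mxEl ?row_mxEr ?(ord1 s).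
Qed.

Lemma appended_no_polydiagonal :
  ~ exists K, polydiagonal K /\ contains (table_mx M) K.
Proof.
move=> [K [Kdiag MK]].
have coverM : hyperplane_cover (table_mx M) M.
  split=> [k a|alpha]; first exact: appended_ge0.
  by rewrite inE ffunE pnatr_eq0 eqb0 negbK.
have := weak_duality Kdiag MK coverM.
have -> : table_weight M = table_weight L + 1.
  rewrite -sum_c -big_split; apply: eq_bigr => k _ /=.
  rewrite big_split_ord big_ord1 row_mxEr; congr (_ + _).
  by apply: eq_bigr => s _; rewrite row_mxEl.
rewrite table_weight_deficiency natrD; have := deficiency_gt0; lra.
Qed.

Lemma swap_newE k (a : 'I_(n + 1)) s : lshift 1 s != a -> M k (swap_new a s) = L k s.
Proof. by rewrite /swap_new => /negbTE ->; rewrite row_mxEl. Qed.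

(** In each row, [alpha'] takes an old position with the same entry as [alpha], so it weighs less
    than 1. The swap then turns its entries into those of [c], which sum to 1. *)
Lemma appended_diagonal alpha :
  cover_weight_at M alpha < 1 ->
  (forall k, alpha k = rshift n ord0 -> exists s, L k s = c k ord0) ->
  exists D, diagonal D /\ contains (mdsub (table_mx M) alpha) D.
Proof.
move=> w1 cL.
have /fin_all_exists[f fP] k : exists s,
    [/\ L k s = M k (alpha k), M k (swap_new (alpha k) s) = c k ord0
      & forall t, t != s -> L k t <= M k (swap_new (alpha k) t)].
  case: (split_ordP (alpha k)) => [s aE|o]; last rewrite (ord1 o) => aE.
    exists s; split; first by rewrite aE row_mxEl.
      by rewrite /swap_new aE eqxx row_mxEr.
    by move=> t ts; rewrite swap_newE // aE (inj_eq (@lshift_inj _ _)).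
  have [s sc] := cL k aE.
  have sw t : M k (swap_new (alpha k) t) = L k t by rewrite swap_newE // aE eq_lrshift.
  by exists s; rewrite aE row_mxEr -aE; split=> // [|t _]; rewrite sw.
apply: (@swap_diagonal _ _ [ffun k => f k]).
- apply: le_lt_trans w1; rewrite le_eqVlt; apply/orP; left; apply/eqP.
  by apply: eq_bigr => k _; rewrite ffunE; case: (fP k).
- by move=> k s; rewrite ffunE => sf; case: (fP k) => _ _; apply.
- rewrite -sum_c le_eqVlt; apply/orP; left; apply/eqP.
  by apply: eq_bigr => k _; rewrite ffunE; case: (fP k).
Qed.

(* Every zero through the new position of row [i] has weight exactly
   [1 - delta], so it is [0] in all other rows. Only row [j] has lost a [0] in
   exchange for [delta]; the new unit is a tight index through [L j r] in which
   [r] is replaced by the new position of row [j]. *)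
Lemma appended_deficiency_diagonal (i j : 'I_d) (r : 'I_n) alpha :
  i != j -> L j r = delta ->
  c = \col_k (if k == i then 1 - delta else if k == j then delta else 0) ->
  alpha i = rshift n ord0 ->
  cover_weight_at M alpha < 1 ->
  exists D, diagonal D /\ contains (mdsub (table_mx M) alpha) D.
Proof.
move=> ij Ljr cE ai w1; have delta0 := deficiency_gt0.
have cj : c j ord0 = delta by rewrite cE mxE eqxx eq_sym (negbTE ij).
(* Row [i] contributes [1 - delta], so any other entry is below [delta] and thus 0: by
   [entry_lt_deficiency] in [L], and by the form of [c] in the new column. *)
have a0 k : k != i -> M k (alpha k) = 0.
  move=> ki; have : M k (alpha k) < delta.
    move: w1; rewrite /cover_weight_at (bigD1 i) //= ai row_mxEr {1}cE mxE eqxx (bigD1 k) //=.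
    have : 0 <= \sum_(l < d | (l != i) && (l != k)) M l (alpha l).
      by apply: sumr_ge0 => l _; apply: appended_ge0.
    lra.
  case: (split_ordP (alpha k)) => [s ->|o ->].
    by rewrite row_mxEl; apply: entry_lt_deficiency.
  rewrite row_mxEr cE mxE (negbTE ki); case: ifP => //.
  by rewrite ltxx.
have [s aj] : exists s, alpha j = lshift 1 s.
  case: (split_ordP (alpha j)) => [s ->|o oE]; first by exists s.
  have := a0 j; rewrite eq_sym ij oE row_mxEr (ord1 o) cj => /(_ isT) d_eq0.
  by move: delta0; rewrite d_eq0 ltxx.
have [|gamma [gj g1]] := @exists_tight_index j r; first by rewrite Ljr gt_eqF.
have gsum : delta + \sum_(k < d | k != j) L k (gamma k) = 1.
  by move: g1; rewrite /cover_weight_at (bigD1 j) //= gj Ljr.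
(* The only old entry a swap can replace sits at [alpha k], where it is 0; in row [i] the swap is
   the inclusion. *)
have rows k t : k != j -> L k t <= M k (swap_new (alpha k) t).
  move=> kj; have [ta|ta] := eqVneq (lshift 1 t) (alpha k); last by rewrite swap_newE.
  suff -> : L k t = 0 by apply: appended_ge0.
  rewrite -(a0 k) -?ta ?row_mxEl //; apply/eqP => ki.
  by move: ta; rewrite ki ai => /eqP; rewrite eq_lrshift.
(* Since [L j s = 0], this index weighs [1 - delta]; the swap restores [delta] in row [j]. *)
apply: (@swap_diagonal _ _ [ffun k => if k == j then s else gamma k]).
- rewrite /cover_weight_at (bigD1 j) //= ffunE eqxx.
  have -> : L j s = 0 by have := a0 j; rewrite eq_sym ij aj row_mxEl => /(_ isT).
  under eq_bigr => k kj do rewrite ffunE (negbTE kj).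
  lra.
- move=> k t; rewrite ffunE; have [->|kj] := eqVneq k j => ts; last exact: rows.
  by rewrite swap_newE // aj (inj_eq (@lshift_inj _ _)).
- rewrite (bigD1 j) //= -gsum ffunE eqxx {1}/swap_new aj eqxx row_mxEr cj lerD2l.
  apply: ler_sum => k kj; rewrite ffunE (negbTE kj); exact: rows.
Qed.

End AppendedColumn.

Lemma appended_diagonally_extremal (c : 'cV[R]_d) :
  [\/ exists alpha : mdidx d n,
        cover_weight_at L alpha = 1 /\ c = \col_k L k (alpha k),
      exists i : 'I_d, c = \col_k (if k == i then 1 else 0)
    | exists i j : 'I_d,
        [/\ i != j, exists r : 'I_n, L j r = delta
          & c = \col_k (if k == i then 1 - delta
                        else if k == j then delta else 0)]] ->
  diagonally_extremal (table_mx (row_mx L c)).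
Proof.
move=> cE; have delta0 := deficiency_gt0; have [[L0 _] _] := optL.
(* Zero entries chosen in all rows form an index of weight 0, a zero of [A], and [zero_weight_le]
   bounds [delta]. *)
have delta1 : delta <= 1.
  have /fin_all_exists[z z0] := exists_zero_entry.
  have w0 : cover_weight_at L [ffun k => z k] = 0 by apply: big1 => k _; rewrite ffunE.
  have /eqP/zero_weight_le : A [ffun k => z k] == 0 by rewrite zero_weight_lt1 w0.
  by rewrite w0 subr_ge0.
have c_ge0 k : 0 <= c k ord0.
  case: cE => [[a [_ ->]]|[i ->]|[i [j [_ _ ->]]]]; rewrite mxE //.
    by case: ifP.
  by do 2?[case: ifP => _] => //; rewrite ?subr_ge0 // ltW.
have sum_c : \sum_k c k ord0 = 1.
  case: cE => [[a [a1 ->]]|[i ->]|[i [j [ij _ ->]]]].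
  - by rewrite -a1; apply: eq_bigr => k _; rewrite mxE.
  - rewrite (bigD1 i) //= mxE eqxx big1 ?addr0 // => k /negbTE ki.
    by rewrite mxE ki.
  - rewrite (bigD1 i) //= mxE eqxx (bigD1 j) 1?eq_sym //= mxE eqxx eq_sym (negbTE ij).
    rewrite big1 ?addr0 ?subrK // => k /andP[/negbTE ki /negbTE kj].
    by rewrite mxE ki kj.
split=> [alpha||alpha].
- by rewrite ffunE; case: (_ <= _); [right | left].
- exact: appended_no_polydiagonal.
rewrite ffunE => /eqP; rewrite pnatr_eq0 eqb0 -ltNge => w1.
have c_lt1 k : alpha k = rshift n ord0 -> c k ord0 < 1.
  move=> ak; apply: le_lt_trans w1; rewrite /cover_weight_at (bigD1 k) //= ak row_mxEr.
  by rewrite lerDl sumr_ge0 // => l _; apply: appended_ge0.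
case: cE => [[a [_ cE]]|[i cE]|[i [j [ij [r Ljr] cE]]]].
- by apply: appended_diagonal => // k _; exists (a k); rewrite cE mxE.
- apply: appended_diagonal => // k /c_lt1; rewrite cE mxE.
  case: ifP => _; first by rewrite ltxx.
  by move=> _; apply: exists_zero_entry.
- have [ai|ai] := eqVneq (alpha i) (rshift n ord0).
    exact: appended_deficiency_diagonal ij Ljr cE ai w1.
  apply: appended_diagonal => // k ak; rewrite cE mxE.
  case: eqP => [ki|_]; first by rewrite -ki ak eqxx in ai.
  by case: eqP => [->|_]; [exists r | apply: exists_zero_entry].
Qed.

End Extension.

Theorem theorem7p5 (R : realType) :
  (forall (d n : nat) (i : 'I_d) (A : mdmx R d.-1 n),
      (1 < d)%N ->
      diagonally_extremal A ->
      diagonally_extremal (layered i A))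
  /\
  (forall (d n : nat) (A : mdmx R d n) (delta : R)
          (L : 'M[R]_(d, n)) (c : 'cV[R]_d),
      (0 < d)%N ->
      diagonally_extremal A ->
      deficiency A delta ->
      optimal_cover A L ->
      [\/ exists alpha : mdidx d n,
            cover_weight_at L alpha = 1 /\ c = \col_k L k (alpha k),
          exists i : 'I_d, c = \col_k (if k == i then 1 else 0)
        | exists i j : 'I_d,
            [/\ i != j, exists r : 'I_n, L j r = delta
              & c = \col_k (if k == i then 1 - delta
                            else if k == j then delta else 0)]] ->
      diagonally_extremal (table_mx (row_mx L c))).
Proof.
split=> [d n i A|d n A delta L c d0 exA defA optL].
  exact: layered_diagonally_extremal.
exact: appended_diagonally_extremal defA optL c.
Qed.
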